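(* Let $U(X)=\sum_{n\ge 0}u_nX^n\in\mathbb{F}_2[[X]]$ be the compositional inverse of the generating function $D(X)=\sum_{n\ge 0}d_nX^n\in\mathbb{F}_2[[X]]$ of the period-doubling sequence. Consider the deterministic finite automaton with output having states $A,B,C,D,E$, initial state $A$, input alphabet $\{0,1\}$, outputs $\mu(A)=\mu(B)=0$ and $\mu(C)=\mu(D)=\mu(E)=1$, and transition function \[ \delta(A,0)=B,\ \delta(A,1)=C,\ \delta(B,0)=\delta(B,1)=B,\ \delta(C,0)=D,\ \delta(C,1)=A, \] \[ \delta(D,0)=E,\ \delta(D,1)=D,\ \delta(E,0)=D,\ \delta(E,1)=B. \] Then this automaton, reading binary representations from the least significant digit to the most significant digit, generates the sequence $(u_n)_{n\ge 0}$; that is, for every $n\ge 0$, $u_n$ is the output of the state reached from $A$ after reading the binary representation of $n$, least significant digit first.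
   Context: The period-doubling sequence $(d_n)_{n\ge 0}$ is defined by $d_n=\nu_2(n+1)\bmod 2\in\{0,1\}$, where $\nu_2(m)$ is the exponent of the highest power of $2$ dividing $m$. The compositional inverse $U(X)$ is the series in $\mathbb{F}_2[[X]]$ with zero constant term such that $D(U(X))=X=U(D(X))$; it exists since $d_0=0$ and $d_1=1$. (The series $D(X)$ is unrelated to the state named $D$.) The binary representation of $n\geq 1$ has no leading zeros, and the binary representation of $0$ is the empty word. *)

(* Defs.v *)
From HB Require Import structures.
From mathcomp Require Import all_boot all_order all_algebra.

Set Implicit Arguments.
Unset Strict Implicit.
Unset Printing Implicit Defensive.

Import GRing.Theory.
Local Open Scope ring_scope.

(* A formal power series is given by its coefficient sequence, and equality of
   series is coefficientwise equality, i.e. =1. *)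
Definition fps (R : Type) : Type := nat -> R.

Section FormalPowerSeries.

Variable R : comNzRingType.
Implicit Types f g : fps R.

Definition fps_one : fps R := fun n => (n == 0%N)%:R.

Definition fps_X : fps R := fun n => (n == 1%N)%:R.

Definition fps_mul f g : fps R := fun n => \sum_(i < n.+1) f i * g (n - i)%N.

Definition fps_exp f k : fps R := iter k (fps_mul f) fps_one.

(* The composite f(g(X)) = \sum_k f_k g(X)^k, which is meaningful when the
   constant term of g is zero. Then g^k has no term of degree < k, so that only
   the indices k <= n contribute to the coefficient of X^n. *)
Definition fps_comp f g : fps R :=
  fun n => \sum_(k < n.+1) f k * fps_exp g k n.

(* For f of zero constant term. *)
Definition fps_comp_inverse f g : Prop :=
  [/\ g 0%N = 0, fps_comp f g =1 fps_X & fps_comp g f =1 fps_X].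

End FormalPowerSeries.

Arguments fps_X {R}.
Arguments fps_one {R}.

Definition period_doubling (n : nat) : nat := (logn 2 n.+1 %% 2)%N.

Definition period_doubling_fps : fps 'F_2 := fun n => (period_doubling n)%:R.

(* Least significant digit first; true is the digit 1. The first argument of
   the auxiliary function only bounds the recursion depth. *)
Fixpoint binary_digits_rec (fuel n : nat) : seq bool :=
  if fuel is fuel'.+1 then
    if n == 0%N then [::] else odd n :: binary_digits_rec fuel' n./2
  else [::].

Definition binary_digits (n : nat) : seq bool := binary_digits_rec n n.

Lemma leq_half_succ n : (n.+1./2 <= n)%N.
Proof. by rewrite leq_uphalf_double -addnn leq_addr. Qed.

Lemma binary_digits_recE fuel n :
  (n <= fuel)%N -> binary_digits_rec fuel n = binary_digits n.
Proof.
rewrite /binary_digits; elim/ltn_ind: n fuel => -[|n] IHn [|fuel] //= le_n.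
have le_half := leq_half_succ n.
by rewrite !IHn // (leq_trans le_half).
Qed.

Lemma binary_digits0 : binary_digits 0 = [::].
Proof. by []. Qed.

Lemma binary_digitsS n :
  binary_digits n.+1 = odd n.+1 :: binary_digits n.+1./2.
Proof.
by rewrite {1}/binary_digits /= binary_digits_recE // leq_half_succ.
Qed.

Lemma binary_digitsK n :
  foldr (fun (b : bool) m => (b + m.*2)%N) 0%N (binary_digits n) = n.
Proof.
elim/ltn_ind: n => -[|n] IHn //.
rewrite binary_digitsS /= IHn; first exact: (odd_double_half n.+1).
by rewrite ltnS leq_half_succ.
Qed.

Lemma last_binary_digits n : last true (binary_digits n).
Proof.
elim/ltn_ind: n => -[|[|n]] IHn //.
have := IHn n.+2./2; rewrite ltnS leq_half_succ => /(_ isT).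
by rewrite [binary_digits n.+2]binary_digitsS [n.+2./2]/= binary_digitsS.
Qed.

Record dfao (A O : Type) := Dfao {
  dfao_state : finType;
  dfao_init : dfao_state;
  dfao_delta : dfao_state -> A -> dfao_state;
  dfao_output : dfao_state -> O
}.

Definition dfao_run A O (M : dfao A O) (w : seq A) : O :=
  dfao_output (foldl (@dfao_delta _ _ M) (dfao_init M) w).

Definition generates_lsd O (M : dfao bool O) (u : nat -> O) : Prop :=
  forall n, u n = dfao_run M (binary_digits n).

Inductive pd_state := qA | qB | qC | qD | qE.

Definition pd_state_to_ord (s : pd_state) : 'I_5 :=
  match s with
  | qA => inord 0 | qB => inord 1 | qC => inord 2 | qD => inord 3 | qE => inord 4
  end.

Definition pd_state_of_ord (i : 'I_5) : pd_state := nth qA [:: qA; qB; qC; qD; qE] i.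

Lemma pd_state_to_ordK : cancel pd_state_to_ord pd_state_of_ord.
Proof. by case; rewrite /pd_state_of_ord /= inordK. Qed.

HB.instance Definition _ := Finite.copy pd_state (can_type pd_state_to_ordK).

Definition pd_delta (s : pd_state) (b : bool) : pd_state :=
  match s, b with
  | qA, false => qB | qA, true => qC
  | qB, false => qB | qB, true => qB
  | qC, false => qD | qC, true => qA
  | qD, false => qE | qD, true => qD
  | qE, false => qD | qE, true => qB
  end.

Definition pd_output (s : pd_state) : 'F_2 :=
  match s with
  | qA | qB => 0
  | qC | qD | qE => 1
  end.

Definition pd_inverse_dfao : dfao bool 'F_2 := Dfao qA pd_delta pd_output.

(* Main.v *)
Require Import Defs.
From mathcomp Require Import all_boot all_order all_algebra.
From mathcomp Require Import ring zify.

Set Implicit Arguments.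
Unset Strict Implicit.
Unset Printing Implicit Defensive.

Import GRing.Theory.
Local Open Scope ring_scope.

(** Since d_{2m} = 0 and d_{2m+1} = 1 + d_m, and since D(X^2) = D(X)^2 over
    F_2, the series D satisfies D = X / (1 + X^2) + X D^2. Substituting U for
    X and using D(U) = X gives the cubic equation
      (1 + U^2) X = U + U (1 + U^2) X^2.
    Multiplying it by 1 + X U cancels every odd power of U but the first and
    leaves the additive equation
      U = X + X^3 (U^2 + U^4).
    By Frobenius, the coefficients of U^2 and U^4 are those of U spread out by
    factors 2 and 4, so this equation is the recurrence u_{2m} = 0, u_1 = 1,
    u_{2m+3} = u_m + [m even] u_{m/2} ([inverse_rec]), which determines U.

    On the automaton side, write s(n) for the output reached from state s. The
    transitions express s(2n) and s(2n+1) through values at n; by induction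
    D(n+1) = C(n) and E(n+1) = A(n) ([pd_value_shift]). These two shift
    identities turn A(2m+3) = C(m+1) into the recurrence of U
    ([pd_value_qA_rec]).

    Series are handled through polynomial truncations: an identity of series
    becomes divisibility by a power of X, arbitrarily large. *)

(** * Polynomials over the two-element field *)

Lemma poly_F2_addpp (p : {poly 'F_2}) : p + p = 0.
Proof.
by rewrite -mulr2n -mulr_natl -polyC_natr (_ : 2%:R = 0) ?polyC0 ?mul0r //; apply/eqP.
Qed.

Lemma F2_sqr (c : 'F_2) : c ^+ 2 = c.
Proof. by case: c => -[|[|]] // i; apply/eqP. Qed.

Lemma poly_F2_sqrD (p q : {poly 'F_2}) : (p + q) ^+ 2 = p ^+ 2 + q ^+ 2.
Proof. by rewrite sqrrD mulr2n poly_F2_addpp addr0. Qed.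

(** Frobenius: the square of p is p(X^2). *)
Lemma coef_poly_F2_sqr (p : {poly 'F_2}) n :
  (p ^+ 2)`_n = if odd n then 0 else p`_n./2.
Proof.
elim/poly_ind: p n => [|p c IHp] n; first by rewrite expr0n !coef0 if_same.
rewrite poly_F2_sqrD exprMn -polyC_exp F2_sqr !coefD coefMXn coefMX !coefC.
by case: n => [|[|n]] /=; rewrite ?add0r ?IHp ?negbK ?subn2 //=; case: odd; rewrite ?addr0.
Qed.

Lemma sqr_poly_F2_sum (a : nat -> 'F_2) (p : {poly 'F_2}) M :
  (\sum_(k < M) a k *: p ^+ k) ^+ 2 = \sum_(k < M) a k *: p ^+ k.*2.
Proof.
elim: M => [|M IHM]; first by rewrite !big_ord0 expr0n.
by rewrite !big_ord_recr /= poly_F2_sqrD IHM exprZn F2_sqr -exprM muln2.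
Qed.

(** * Composition of series through truncations *)

Section Truncation.

Variables (R : comNzRingType) (g : fps R) (N : nat).
Let p : {poly R} := \poly_(i < N) g i.

Lemma coef_truncation_exp k n : (n < N)%N -> (p ^+ k)`_n = fps_exp g k n.
Proof.
elim: k n => [|k IHk] n lt_nN; first by rewrite expr0 coef1.
rewrite exprS coefM /fps_exp iterS; apply: eq_bigr => i _.
have := ltn_ord i => lt_in.
rewrite coef_poly (leq_ltn_trans _ lt_nN) -1?ltnS // IHk //.
by rewrite (leq_ltn_trans (leq_subr _ _) lt_nN).
Qed.

Lemma truncation_exp_low k n :
  g 0%N = 0 -> (n < k)%N -> (p ^+ k)`_n = 0.
Proof.
move=> g0 lt_nk.
have [q ->] : exists q, p = q * 'X.
  exists (\poly_(i < N.-1) g i.+1); apply/polyP => -[|i]; rewrite coefMX !coef_poly /=.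
    by rewrite g0 if_same.
  by case: (N).
by rewrite exprMn coefMXn lt_nk.
Qed.

(** Terms of index k > n in the outer series do not affect the coefficient n: for
    g of zero constant term, g^k has no nonzero coefficient of index less than k. *)
Lemma coef_truncation_comp (f : fps R) M n :
    g 0%N = 0 -> (n < M <= N)%N ->
  (\sum_(k < M) f k *: p ^+ k)`_n = fps_comp f g n.
Proof.
move=> g0 /andP[lt_nM le_MN]; rewrite coef_sum /fps_comp.
rewrite (big_ord_widen _ (fun k => f k * fps_exp g k n) lt_nM) [RHS]big_mkcond.
apply: eq_bigr => k _; rewrite coefZ ltnS; case: leqP => [_|lt_nk].
  by rewrite coef_truncation_exp // (leq_trans lt_nM).
by rewrite truncation_exp_low ?mulr0.
Qed.

End Truncation.

(** * The functional equation of the period-doubling series *)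

Lemma period_doubling_fps_even m : period_doubling_fps m.*2 = 0.
Proof.
rewrite /period_doubling_fps /period_doubling lognE /= dvdn2 /=.
by rewrite odd_double.
Qed.

Lemma period_doubling_fps_odd m :
  period_doubling_fps m.*2.+1 = 1 + period_doubling_fps m.
Proof.
rewrite /period_doubling_fps /period_doubling -doubleS -mul2n.
rewrite lognM // (pfactorK 1) // !modn2 add1n /=.
by case: odd; apply/eqP.
Qed.

(** A truncated form of (1 + X^2) D = X (1 + (1 + X^2) D^2), evaluated at p; the
    extra term p ^+ M.*2 comes from cutting the geometric series 1 / (1 + p^2)
    after M terms. *)
Lemma period_doubling_sum_double (p : {poly 'F_2}) M :
  (1 + p ^+ 2) * \sum_(k < M.*2) period_doubling_fps k *: p ^+ k =
  p * (1 + p ^+ M.*2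
       + (1 + p ^+ 2) * (\sum_(k < M) period_doubling_fps k *: p ^+ k) ^+ 2).
Proof.
rewrite sqr_poly_F2_sum; elim: M => [|M IHM].
  by rewrite !big_ord0 !mulr0 expr0 addr0 poly_F2_addpp mulr0.
rewrite doubleS !big_ord_recr /= !mulrDr IHM.
rewrite period_doubling_fps_even period_doubling_fps_odd scale0r mulr0 addr0.
rewrite scalerDl scale1r -!mul_polyC !exprS; set S := \sum_(i < M) _.
set c := _%:P; set q := p ^+ M.*2.
rewrite -[RHS]addr0 -(poly_F2_addpp (p * q)); ring.
Qed.

(** * The recurrence satisfied by the compositional inverse *)

Lemma dvdp_XnP (F : fieldType) N (p : {poly F}) :
  (forall n, (n < N)%N -> p`_n = 0) -> 'X^N %| p.
Proof.
move=> p0; rewrite -(poly_take_drop N p) dvdp_addl ?dvdp_mull //.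
rewrite (_ : take_poly N p = 0) ?dvdp0 //.
by apply/polyP => i; rewrite coef_take_poly coef0; case: ifP => // /p0.
Qed.

Lemma coef_dvdp_Xn (F : fieldType) N (p : {poly F}) n :
  'X^N %| p -> (n < N)%N -> p`_n = 0.
Proof. by move=> /dvdpP[q ->] lt_nN; rewrite coefMXn lt_nN. Qed.

Section Inverse.

Variable U : fps 'F_2.
Hypothesis U0 : U 0%N = 0.
Hypothesis DU : fps_comp period_doubling_fps U =1 fps_X.

(** The equation U = X + X^3 (U^2 + U^4) modulo X^(2M). Truncating D(U) at M terms
    gives X only modulo X^M, but it enters the cubic equation squared, which
    restores the precision 2M. *)
Lemma inverse_quartic M (u := \poly_(i < M.*2) U i) :
  'X^(M.*2) %| u + 'X + 'X^3 * (u ^+ 2 + u ^+ 4).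
Proof.
pose S L := \sum_(k < L) period_doubling_fps k *: u ^+ k.
have S_X L : (L <= M.*2)%N -> 'X^L %| S L + 'X.
  move=> le_L; apply: dvdp_XnP => n lt_nL.
  rewrite coefD coefX coef_truncation_comp ?lt_nL // DU /fps_X.
  by case: eqP => _; apply/eqP.
have u_X : 'X^(M.*2) %| u ^+ M.*2.
  by apply: dvdp_XnP => n; apply: truncation_exp_low.
have S2_X : 'X^(M.*2) %| (S M + 'X) ^+ 2.
  by rewrite -muln2 exprM dvdp_exp2r // S_X // -addnn leq_addr.
have Sdouble := period_doubling_sum_double u M.
rewrite -/(S _) -/(S _) in Sdouble.
(* The right-hand side is 1 + X u times a sum of three error terms, those made in
   the cubic equation by truncating D at 2M terms, D at M terms and the geometric
   series 1 / (1 + u^2) at M terms. *)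
have -> : u + 'X + 'X^3 * (u ^+ 2 + u ^+ 4) =
    (1 + 'X * u) * ((1 + u ^+ 2) * (S M.*2 + 'X)
      + u * (1 + u ^+ 2) * (S M + 'X) ^+ 2 + u * u ^+ M.*2).
  rewrite poly_F2_sqrD [(1 + u ^+ 2) * (_ + _)]mulrDr Sdouble.
  set s := S M; set q := u ^+ M.*2.
  (* The two sides agree over the integers up to z + z, for this z. *)
  set z := (1 + 'X * u) * (u * q + u * (1 + u ^+ 2) * s ^+ 2)
     + 'X * u ^+ 2 + 'X^2 * u + 'X^2 * u ^+ 3.
  rewrite -[LHS]addr0 -(poly_F2_addpp z) /z; ring.
apply: dvdp_mull; apply: dvdp_add; last exact: dvdp_mull.
by apply: dvdp_add; apply: dvdp_mull => //; apply: S_X.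
Qed.

Lemma inverse_coef n :
  U n + (n == 1%N)%:R
  + (if (n < 3)%N then 0 else (if odd (n - 3) then 0 else U (n - 3)./2)
       + (if odd (n - 3) || odd (n - 3)./2 then 0 else U (n - 3)./2./2)) = 0.
Proof.
have lt_n : (n < n.+1.*2)%N by lia.
have lt_poly m : (m <= n)%N -> (\poly_(i < n.+1.*2) U i)`_m = U m.
  by move=> le_m; rewrite coef_poly (leq_ltn_trans le_m).
have := coef_dvdp_Xn (inverse_quartic n.+1) lt_n.
set u := \poly_(_ < _) _; rewrite !coefD coefX coefXnM lt_poly // => coef_n.
rewrite -[RHS]coef_n.
congr (_ + _); case: ifP => // _.
rewrite coefD (exprM u 2 2) !coef_poly_F2_sqr !lt_poly; try lia.
by do 2 case: odd.
Qed.

Lemma inverse_rec :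
  [/\ forall m, U m.*2 = 0, U 1%N = 1
    & forall m, U m.*2.+3 = U m + (if odd m then 0 else U m./2)].
Proof.
have addK (a b : 'F_2) : a + b = 0 -> a = b.
  by case: a b => -[|[|]] // i [[|[|]] //] j /eqP //; move=> _; apply/eqP.
split=> [[|[|m]]||m]; first exact: U0; have:= inverse_coef.
- by move=> /(_ 2%N); rewrite !addr0.
- move=> /(_ m.+2.*2); rewrite (_ : m.+2.*2 - 3 = m.*2.+1)%N; last by lia.
  by rewrite !doubleS /= odd_double /= !addr0.
- by move=> /(_ 1%N) /=; rewrite addr0; apply: addK.
move=> /(_ m.*2.+3); rewrite (_ : m.*2.+3 - 3 = m.*2)%N; last by lia.
by rewrite /= odd_double doubleK /= addr0; apply: addK.
Qed.

End Inverse.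

(** * The sequences read from the states of the automaton *)

Definition pd_value (s : pd_state) (n : nat) : 'F_2 :=
  pd_output (foldl pd_delta s (binary_digits n)).

(** When b and n are both 0 there is no digit to read; the identity still holds
    because reading the digit 0 never changes the output, that is, the
    automaton ignores leading zeros. *)
Lemma pd_value_digit s (b : bool) n :
  pd_value s (b + n.*2) = pd_value (pd_delta s b) n.
Proof.
rewrite /pd_value; case: b; rewrite ?add1n ?add0n.
  by rewrite binary_digitsS /= odd_double uphalf_double.
case: n => [|n]; first by case: s.
by rewrite doubleS binary_digitsS /= odd_double doubleK.
Qed.

Lemma pd_value_even s n : pd_value s n.*2 = pd_value (pd_delta s false) n.
Proof. exact: pd_value_digit s false n. Qed.

Lemma pd_value_odd s n : pd_value s n.*2.+1 = pd_value (pd_delta s true) n.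
Proof. exact: pd_value_digit s true n. Qed.

Lemma pd_value_qB n : pd_value qB n = 0.
Proof.
by rewrite /pd_value; elim: (binary_digits n) => [|[] w].
Qed.

Definition pd_valueE := (pd_value_even, pd_value_odd, pd_value_qB).

(** The two identities feed each other: reading the digits of n and n + 1
    (swapping the digit unless a carry occurs) leads either to equal states or to
    one of the same two pairs, (D, C) or (E, A), with n halved. *)
Lemma pd_value_shift n :
  pd_value qD n.+1 = pd_value qC n /\ pd_value qE n.+1 = pd_value qA n.
Proof.
elim/ltn_ind: n => n IHn; rewrite -(odd_double_half n).
case: (boolP (odd n)) => odd_n /=; last by rewrite add0n !pd_valueE.
have lt_half : (n./2 < n)%N by lia.
have [IHD IHE] := IHn _ lt_half.
by rewrite add1n -doubleS !pd_valueE /= !IHD !IHE.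
Qed.

Lemma pd_value_qA_rec m :
  pd_value qA m.*2.+3 = pd_value qA m + (if odd m then 0 else pd_value qA m./2).
Proof.
rewrite -doubleS pd_value_odd /=.
have := odd_double_half m; case: (odd m); move: m./2 => k <-.
  by rewrite add1n -doubleS !pd_valueE addr0 /= (pd_value_shift _).1.
by rewrite add0n !pd_valueE add0r.
Qed.

Theorem mainTheorem5 (U : fps 'F_2)
  (hU : fps_comp_inverse period_doubling_fps U) :
  generates_lsd pd_inverse_dfao U.
Proof.
case: hU => U0 DU _; have [Ueven U1 Uodd] := inverse_rec U0 DU.
move=> n; rewrite -[RHS]/(pd_value qA n).
(* Both sequences satisfy the same recurrence, so they agree by strong induction. *)
elim/ltn_ind: n => n IHn; rewrite -(odd_double_half n) in IHn *.
case: (odd n) n./2 IHn => -[|m] IHn; rewrite ?add0n ?add1n ?Ueven ?pd_valueE //.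
rewrite -pd_value_odd doubleS Uodd pd_value_qA_rec !IHn //; lia.
Qed.
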